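(* There exists a hereditarily closed family $\mathcal{H}$ of finite $3$-partite $3$-hypergraphs so that every $H\in\mathcal{H}$ is slice-wise $7$-stable, but $\mathcal{H}$ does not satisfy stable regularity.
   Context: A finite $3$-partite $3$-hypergraph is $H=(E;X_1,X_2,X_3)$ with $X_i$ finite nonempty sets and $E\subseteq X_1\times X_2\times X_3$. A family $\mathcal{H}$ is hereditarily closed if whenever $(E;X_1,X_2,X_3)\in\mathcal{H}$ and $\emptyset\ne X_i'\subseteq X_i$, also $(E\cap\prod_iX_i';X_1',X_2',X_3')\in\mathcal{H}$. A binary relation $R\subseteq A\times B$ is $d$-stable if there are no $a_1,\dots,a_d\in A$, $b_1,\dots,b_d\in B$ with $(a_i,b_j)\in R\iff i\le j$ for all $1\le i,j\le d$. $H$ is slice-wise $d$-stable if for all $x\in X_1$, $y\in X_2$, $z\in X_3$ the slices $E_x\subseteq X_2\times X_3$, $E_y\subseteq X_1\times X_3$, $E_z\subseteq X_1\times X_2$ are $d$-stable. $\mathcal{H}$ satisfies stable regularity if for every $\varepsilon>0$ there is $N=N(\varepsilon)$ so that for any $H\in\mathcal{H}$ there exist $N'\le N$ and partitions $X_i=\bigsqcup_{1\le t<N'}A_{i,t}$ ($1\le i\le 3$) so that for any $1\le t_1,t_2,t_3<N'$, $\frac{|E\cap(A_{1,t_1}\times A_{2,t_2}\times A_{3,t_3})|}{|A_{1,t_1}\times A_{2,t_2}\times A_{3,t_3}|}\in[0,\varepsilon)\cup(1-\varepsilon,1]$ (required only when the box is nonempty; parts may be empty). *)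

(* Defs.v *)
From HB Require Import structures.
From mathcomp Require Import all_boot all_order all_algebra.
From mathcomp Require Import reals.

Set Implicit Arguments.
Unset Strict Implicit.
Unset Printing Implicit Defensive.

Import Order.TTheory GRing.Theory Num.Theory.
Local Open Scope ring_scope.

Record hypergraph := Hypergraph {
  V1 : finType;
  V2 : finType;
  V3 : finType;
  V1_gt0 : (0 < #|V1|)%N;
  V2_gt0 : (0 < #|V2|)%N;
  V3_gt0 : (0 < #|V3|)%N;
  edges : {set V1 * V2 * V3}
}.

Lemma card_sub_gt0 (T : finType) (A : {set T}) :
  A != set0 -> (0 < #|{: {x : T | x \in A}}|)%N.
Proof. by rewrite card_sig card_gt0. Qed.

(* Vertex classes are types, so passing to nonempty subsets X_i' of the
   vertex classes means taking the subtypes {x | x \in X_i'}, with the edge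
   set pulled back along the inclusions. *)
Definition induced (H : hypergraph)
    (X1 : {set V1 H}) (X2 : {set V2 H}) (X3 : {set V3 H})
    (X1n0 : X1 != set0) (X2n0 : X2 != set0) (X3n0 : X3 != set0) : hypergraph :=
  @Hypergraph {x : V1 H | x \in X1} {y : V2 H | y \in X2} {z : V3 H | z \in X3}
    (card_sub_gt0 X1n0) (card_sub_gt0 X2n0) (card_sub_gt0 X3n0)
    [set p | (val p.1.1, val p.1.2, val p.2) \in edges H].

Definition hereditarily_closed (F : hypergraph -> Prop) : Prop :=
  forall (H : hypergraph), F H ->
  forall (X1 : {set V1 H}) (X2 : {set V2 H}) (X3 : {set V3 H})
    (X1n0 : X1 != set0) (X2n0 : X2 != set0) (X3n0 : X3 != set0),
    F (induced X1n0 X2n0 X3n0).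

Definition stable (d : nat) (A B : finType) (R : {set A * B}) : Prop :=
  ~ exists (a : 'I_d -> A) (b : 'I_d -> B),
      forall i j : 'I_d, (a i, b j) \in R <-> (i <= j)%N.

Definition slice1 (H : hypergraph) (x : V1 H) : {set V2 H * V3 H} :=
  [set p | (x, p.1, p.2) \in edges H].

Definition slice2 (H : hypergraph) (y : V2 H) : {set V1 H * V3 H} :=
  [set p | (p.1, y, p.2) \in edges H].

Definition slice3 (H : hypergraph) (z : V3 H) : {set V1 H * V2 H} :=
  [set p | (p.1, p.2, z) \in edges H].

Definition slicewise_stable (d : nat) (H : hypergraph) : Prop :=
  [/\ forall x : V1 H, stable d (slice1 x),
      forall y : V2 H, stable d (slice2 y)
    & forall z : V3 H, stable d (slice3 z)].

(* The parts are the A t with 1 <= t < n; they may be empty, and the values of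
   A outside this range are irrelevant. *)
Definition splits (T : finType) (n : nat) (A : nat -> {set T}) : Prop :=
  (forall s t : nat, (1 <= s < n)%N -> (1 <= t < n)%N -> s != t ->
     [disjoint A s & A t]) /\
  \bigcup_(1 <= t < n) A t = [set: T].

Definition box (T1 T2 T3 : finType)
    (A1 : {set T1}) (A2 : {set T2}) (A3 : {set T3}) : {set T1 * T2 * T3} :=
  setX (setX A1 A2) A3.

Definition density (R : realType) (T : finType) (E B : {set T}) : R :=
  #|E :&: B|%:R / #|B|%:R.

Definition stable_regularity (R : realType) (F : hypergraph -> Prop) : Prop :=
  forall eps : R, 0 < eps ->
  exists N : nat, forall H : hypergraph, F H ->
  exists N' : nat, (N' <= N)%N /\
  exists (A1 : nat -> {set V1 H}) (A2 : nat -> {set V2 H})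
         (A3 : nat -> {set V3 H}),
    [/\ splits N' A1, splits N' A2, splits N' A3
      & forall t1 t2 t3 : nat,
          (1 <= t1 < N')%N -> (1 <= t2 < N')%N -> (1 <= t3 < N')%N ->
          let B := box (A1 t1) (A2 t2) (A3 t3) in
          B != set0 ->
          (density R (edges H) B \in `[0, eps[) \/
          (density R (edges H) B \in `]1 - eps, 1])].

(* Main.v *)
(* The family of all slicewise 7-stable hypergraphs is hereditarily closed, so
   it suffices to find members of it that have no regular partition with a
   bounded number of parts. Let the three vertex classes be the leaves of the
   ternary tree of depth n, and let (x, y, z) be an edge when at the first level
   where x, y, z are not all equal their digits are pairwise distinct. Two
   vertices determine the level at which an edge through them splits, which
   makes every slice a disjoint union of complete bipartite graphs.

   Suppose all boxes of three given partitions are homogeneous up to c^3. If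
   parts A, B, C each have a fraction at least c in one of three distinct children
   of a node, then at least a fraction c^3 of the box are edges, and as many are
   non-edges if also A has a fraction at least c outside its child, since
   two of the coordinates determine the child that contains the third. So each
   part has more than 1 - c of its mass in its child. Starting from the root,
   each part is thus concentrated on a single cone that shrinks down the tree as
   long as, at each node, all children meet heavy parts of all three partitions.
   A node where this fails has a child covered by light parts. Only a bounded
   multiple of c of each part can lie in such children at the first failures, so
   at least half of the leaves have no failure above them. These leaves are
   singleton parts, which is impossible when 3^n is large compared with the
   number of parts. *)
Require Import Defs.
From HB Require Import structures.
From mathcomp Require Import all_boot all_order all_algebra.
From mathcomp Require Import reals.
From mathcomp Require Import perm.
From mathcomp Require Import zify.

Set Implicit Arguments.
Unset Strict Implicit.
Unset Printing Implicit Defensive.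

(** * Leaves and cones of the ternary tree *)

Section TernaryTree.
Variable n : nat.
Implicit Types (x y z : n.-tuple 'I_3) (s : seq 'I_3) (j : 'I_3) (k l : nat).
Implicit Types A B C : {set n.-tuple 'I_3}.

Definition digit x k : 'I_3 := nth ord0 x k.

Definition cone s : {set n.-tuple 'I_3} := [set x : n.-tuple _ | prefix s x].

Lemma take_cone s x : x \in cone s -> take (size s) x = s.
Proof. by rewrite inE prefixE => /eqP. Qed.

Lemma cone_nil : cone [::] = setT.
Proof. by apply/setP => x; rewrite !inE prefix0s. Qed.

Lemma cone_full x : cone x = [set x].
Proof.
apply/setP => y; rewrite !inE prefixE size_tuple -{1}(size_tuple y) take_size.
by rewrite -val_eqE.
Qed.

Lemma mem_cone_rcons s x j : size s < n ->
  (x \in cone (rcons s j)) = (x \in cone s) && (digit x (size s) == j).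
Proof.
move=> sn; rewrite !inE !prefixE size_rcons (take_nth ord0) ?size_tuple //.
by rewrite eqseq_rcons.
Qed.

Lemma card_cone_split s B : size s < n ->
  #|B :&: cone s| = \sum_j #|B :&: cone (rcons s j)|.
Proof.
move=> sn; rewrite -sum1_card (partition_big (digit^~ (size s)) predT) //=.
apply: eq_bigr => j _; rewrite -sum1_card; apply: eq_bigl => x.
by rewrite !in_setI mem_cone_rcons // andbA.
Qed.

(** Exchanging the digits [j] and [j'] at level [size s] is an involution of the leaves that carries
    one cone into the other. *)
Lemma leq_card_cone_rcons s j j' : size s < n ->
  #|cone (rcons s j)| <= #|cone (rcons s j')|.
Proof.
move=> sn.
pose h x : n.-tuple 'I_3 := [tuple if val k == size s
  then tperm j j' (tnth x k) else tnth x k | k < n].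
have dh x k : k < n ->
    digit (h x) k = if k == size s then tperm j j' (digit x k) else digit x k.
  move=> kn; rewrite /digit -[k]/(val (Ordinal kn)) -!tnth_nth.
  by rewrite tnth_mktuple.
have ext x y : (forall k, k < n -> digit x k = digit y k) -> x = y.
  move=> e; apply: val_inj; apply: (@eq_from_nth _ ord0) => [|k].
    by rewrite !size_tuple.
  by rewrite size_tuple; exact: e.
have hK : involutive h.
  by move=> x; apply: ext => k kn; rewrite !dh //; case: eqP; rewrite ?tpermK.
rewrite -(card_imset _ (inv_inj hK)); apply/subset_leq_card/subsetP => _ /imsetP[x + ->].
rewrite !mem_cone_rcons // => /andP[xs /eqP xj].
rewrite dh // eqxx xj tpermL eqxx andbT.
rewrite inE prefixE -(take_cone xs).
apply/eqP/(@eq_from_nth _ ord0);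
  rewrite ?size_take ?size_tuple ?sn ?size_takel ?size_tuple 1?ltnW // => k ks.
rewrite !nth_take ?sn //.
rewrite -/(digit (h x) k) dh ?(ltn_trans ks) //.
by rewrite ltn_eqF.
Qed.

Lemma card_cone_rcons s j : size s < n -> #|cone s| = 3 * #|cone (rcons s j)|.
Proof.
move=> sn; rewrite -(setTI (cone s)) card_cone_split //.
rewrite (eq_bigr (fun=> #|cone (rcons s j)|)) ?sum_nat_const ?card_ord // => k _.
by rewrite setTI; apply/eqP; rewrite eqn_leq !leq_card_cone_rcons.
Qed.

(* Homogeneity is tested at density eps = c^3 with c = 1/72, and a part is
   heavy in a cone if it has at least a fraction c of its elements there. *)
Definition heavy A s := #|A| <= 72 * #|A :&: cone s|.
Definition concentrated A s := 72 * #|A :\: cone s| < #|A|.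

(** * Escaping leaves of three partitions given by labels *)

Section Partition.
Variables (N : nat) (f : 'I_3 -> n.-tuple 'I_3 -> 'I_N).
Implicit Type i : 'I_3.

Definition part i x := [set y | f i y == f i x].

Definition supported i s := [exists x, heavy (part i x) s].
Definition alive s := [forall i, forall j, supported i (rcons s j)].
(** Only proper prefixes are tested: a good node may itself fail to be alive. *)
Definition good s := [forall k : 'I_(size s), alive (take k s)].

Lemma goodP s : reflect (forall k, k < size s -> alive (take k s)) (good s).
Proof.
apply: (iffP forallP) => [h k ks|h k]; last exact: h.
by have := h (Ordinal ks).
Qed.

Lemma good_rcons s j : good s -> alive s -> good (rcons s j).
Proof.
move=> /goodP gs als; apply/goodP => k; rewrite size_rcons ltnS leq_eqVlt.
case/predU1P => [->|ks]; first by rewrite -cats1 take_size_cat.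
by rewrite -cats1 takel_cat 1?ltnW //; exact: gs.
Qed.

(* The leaves whose path, at its first node that is not alive, goes on to a
   child where every part of the [i]-th partition is light. *)
Definition escape i : {set n.-tuple 'I_3} :=
  [set x : n.-tuple 'I_3 | [exists k : 'I_n,
     good (take k x) && ~~ supported i (take k.+1 x)]].

Lemma escapeP i x : reflect (exists k, [/\ k < n, good (take k x) &
  ~~ supported i (take k.+1 x)]) (x \in escape i).
Proof.
rewrite inE; apply: (iffP existsP) => [[k /andP[gk sk]]|[k [kn gk sk]]].
  by exists k.
by exists (Ordinal kn); rewrite /= gk sk.
Qed.

Lemma alive_supported i s j : alive s -> supported i (rcons s j).
Proof. by move=> /forallP/(_ i)/forallP. Qed.

Lemma good_supported i x k l : good (take l x) -> k < l -> k < n ->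
  supported i (take k.+1 x).
Proof.
move=> /goodP + kl kn => /(_ k); rewrite (take_takel _ (ltnW kl)).
rewrite (take_nth ord0) ?size_tuple // leq_min kl kn => h.
exact/alive_supported/h.
Qed.

(* Decompose along the first node of each path that is not alive: one of its
   three children, a third of its cone, lies in some [escape i]. *)
Lemma bad_leaves_card :
  #|[set x : n.-tuple 'I_3 | ~~ good x]| <= 3 * \sum_i #|escape i|.
Proof.
pose D := [set x : n.-tuple 'I_3 | ~~ good x].
pose U := \bigcup_i escape i.
suff: forall m s, size s + m = n -> good s ->
    #|D :&: cone s| <= 3 * #|U :&: cone s|.
  move=> /(_ n [::] erefl); rewrite cone_nil !setIT => h.
  apply: leq_trans (h _) _; first by apply/goodP.
  rewrite leq_mul2l /=.
  apply: (big_ind2 (fun B m => #|B : {set _}| <= m)) => [|B a C b hB hC|//].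
    by rewrite cards0.
  by apply: leq_trans (leq_card_setU _ _) _; exact: leq_add.
elim=> [|m IH] s; rewrite ?addn0 => sn gs.
  suff -> : D :&: cone s = set0 by rewrite cards0.
  apply/setP => x; rewrite in_set0; apply: contraTF gs => /setIP[].
  by rewrite inE => + /take_cone; rewrite sn take_oversize ?size_tuple // => + <-.
have {}sn' : size s < n by lia.
have [als|] := boolP (alive s).
  rewrite !card_cone_split // big_distrr; apply: leq_sum => j _ /=.
  by apply: IH; [rewrite size_rcons; lia|exact: good_rcons].
case/forallPn => i /forallPn[j nsup].
apply: leq_trans (subset_leq_card (subsetIr _ _)) _.
rewrite (card_cone_rcons j) // leq_mul2l /=; apply: subset_leq_card.
apply/subsetP => x xj; have := take_cone xj; rewrite size_rcons => tx.
move: xj; rewrite in_setI mem_cone_rcons // => /andP[xs _]; rewrite xs andbT.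
apply/bigcupP; exists i => //; apply/escapeP; exists (size s).
by split; rewrite ?tx // take_cone.
Qed.

Hypothesis dichotomy : forall s, size s < n -> alive s ->
  forall i x j, heavy (part i x) (rcons s j) -> concentrated (part i x) (rcons s j).

(* Descend along cones in which the part is concentrated. At the first one
   that is not alive, the part has less than c of its elements outside the cone
   and less than c in each light child: less than 4c = 1/18 in total. *)
Lemma part_escape_card i x : 18 * #|part i x :&: escape i| <= #|part i x|.
Proof.
set A := part i x; set U := escape i.
suff: forall m s, size s + m = n -> good s -> concentrated A s ->
    18 * #|A :&: U| <= #|A|.
  move=> /(_ n [::] erefl); apply; first exact/goodP.
  rewrite /concentrated cone_nil setDT cards0 muln0 card_gt0.
  by apply/set0Pn; exists x; rewrite inE.
(* A failure strictly above [s] contradicts [good s]; one strictly below makes [s] alive. *)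
have Usupp s y : good s -> y \in U -> y \in cone s ->
    size s < n /\ (~~ alive s -> ~~ supported i (rcons s (digit y (size s)))).
  move=> gs /escapeP[k [kn gk nsk]] ys; have tks := take_cone ys.
  have [ks|ks|ks] := ltngtP k (size s).
  - by rewrite (@good_supported i y k (size s)) // ?tks in nsk.
  - have sn := ltn_trans ks kn; split=> //.
    have := goodP _ gk (size s).
    by rewrite (take_takel _ (ltnW ks)) tks size_tuple leq_min ks sn => ->.
  - by move: nsk; rewrite -ks kn (take_nth ord0) ?size_tuple // ks tks => nsk.
elim=> [|m IH] s sn gs cs.
  apply: leq_trans (ltnW cs); rewrite leq_mul //; apply: subset_leq_card.
  apply/subsetP => y; rewrite in_setI in_setD => /andP[yA yU]; rewrite yA andbT.
  by apply/negP => ys; have [] := Usupp _ _ gs yU ys; rewrite -sn addn0 ltnn.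
have {}sn' : size s < n by lia.
have [als|nals] := boolP (alive s).
  (* Otherwise less than 1/72 of [A] lies outside the cone and at most 3/72 inside. *)
  have [j hj] : exists j, heavy A (rcons s j).
    apply/existsP; apply: contraT; rewrite negb_exists => /forallP h.
    have := cardsID (cone s) A; rewrite card_cone_split // => eA.
    have : \sum_j 72 * #|A :&: cone (rcons s j)| <= \sum_(j < 3) #|A|.
      by apply: leq_sum => j _; have := h j; rewrite /heavy -ltnNge => /ltnW.
    rewrite -big_distrr sum_nat_const card_ord /=; move: cs; rewrite /concentrated.
    have arith a b c : a + b = c -> 72 * b < c -> 72 * a <= 3 * c -> false by lia.
    exact: arith eA.
  apply: (IH (rcons s j)); first by rewrite size_rcons; lia.
    exact: good_rcons.
  exact: dichotomy.
have leqD : 72 * #|(A :&: U) :\: cone s| <= #|A|.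
  apply: leq_trans (ltnW cs); rewrite leq_mul //; apply: subset_leq_card.
  by apply: setSD; exact: subsetIl.
(* A supported child contains no escaping leaf; an unsupported one is light for [A]. *)
have : \sum_j 72 * #|A :&: U :&: cone (rcons s j)| <= \sum_(j < 3) #|A|.
  apply: leq_sum => j _; have [sj|nsj] := boolP (supported i (rcons s j)).
    suff -> : A :&: U :&: cone (rcons s j) = set0 by rewrite cards0.
    apply/setP => y; rewrite in_set0; apply: contraTF sj.
    rewrite in_setI mem_cone_rcons // => /andP[/setIP[_ yU] /andP[ys /eqP <-]].
    by have [_ /(_ nals)] := Usupp _ _ gs yU ys.
  move: nsj; rewrite negb_exists => /forallP/(_ x); rewrite -/A /heavy -ltnNge.
  move=> /ltnW; apply: leq_trans; rewrite leq_mul2l /=; apply: subset_leq_card.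
  by apply: setSI; exact: subsetIl.
rewrite -big_distrr sum_nat_const card_ord -card_cone_split //=.
have arith a b c d : a + b = c -> 72 * b <= d -> 72 * a <= 3 * d -> 18 * c <= d.
  by lia.
exact: arith (cardsID _ _) leqD.
Qed.

(** The parent of [x] is alive, so some part is heavy, hence concentrated, in the leaf [x]. It has
    at most 72 elements, so less than one outside [x]. *)
Lemma good_leaf_part x y i : 0 < n -> good x -> f i y = f i x -> y = x.
Proof.
move=> n0 gx fyx; have n1 : n.-1 < n by lia.
have ex : rcons (take n.-1 x) (digit x n.-1) = x.
  by rewrite -take_nth ?size_tuple // prednK // -{2}(take_size x) size_tuple.
have st : size (take n.-1 x) = n.-1 by rewrite size_takel // size_tuple ltnW.
have alx : alive (take n.-1 x) by apply: (goodP _ gx); rewrite size_tuple.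
have /existsP[z hz] := alive_supported i (digit x n.-1) alx.
have := dichotomy _ alx hz; rewrite st => /(_ n1); move: hz.
rewrite /heavy /concentrated ex cone_full.
set A := part i z => h1 h2.
have zA : 0 < #|A| by rewrite card_gt0; apply/set0Pn; exists z; rewrite inE.
have lx : #|A :&: [set x]| <= 1.
  by apply: leq_trans (subset_leq_card (subsetIr _ _)) _; rewrite cards1.
have /eqP : #|A :\: [set x]| = 0.
  have arith a b c : c <= 72 * a -> 72 * b < c -> a <= 1 -> b = 0 by lia.
  exact: arith h1 h2 lx.
rewrite cards_eq0 setD_eq0 subset1 -cards_eq0 -[#|A| == 0]negbK -lt0n zA orbF.
move/eqP => eA; have : y \in A.
  have : x \in A by rewrite eA set11.
  by rewrite !inE fyx.
by rewrite eA => /set1P.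
Qed.

(** Each [escape i] holds at most 1/18 of the leaves, so at most 9/18 are bad. Labels separate the
    good ones. *)
Lemma leaves_leq_parts : 0 < n -> 3 ^ n <= 2 * N.
Proof.
move=> n0; pose D := [set x : n.-tuple 'I_3 | ~~ good x].
have cT : #|{: n.-tuple 'I_3}| = 3 ^ n by rewrite card_tuple card_ord.
have cU i : 18 * #|escape i| <= 3 ^ n.
  rewrite -sum1_card (partition_big (f i) predT) //= big_distrr -cT -sum1_card.
  rewrite (partition_big (f i) predT) //=; apply: leq_sum => t _.
  case: (pickP (fun x => f i x == t)) => [x /eqP ext|e].
    have eA : #|part i x| = \sum_(y | f i y == t) 1.
      by rewrite -sum1_card; apply: eq_bigl => y; rewrite inE ext.
    have <- : #|part i x :&: escape i| = \sum_(y in escape i | f i y == t) 1.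
      by rewrite -sum1_card; apply: eq_bigl => y; rewrite in_setI inE ext andbC.
    by rewrite -eA; exact: part_escape_card.
  by rewrite big_pred0 // => y; rewrite e andbF.
have cD : 2 * #|D| <= 3 ^ n.
  have : \sum_i 18 * #|escape i| <= \sum_(i < 3) 3 ^ n.
    by apply: leq_sum => i _; exact: cU.
  rewrite -big_distrr sum_nat_const card_ord /=.
  have arith a b c : a <= 3 * b -> 18 * b <= 3 * c -> 2 * a <= c by lia.
  exact: arith bad_leaves_card.
suff : #|~: D| <= N by have := cardsC D; rewrite cT; lia.
rewrite -[leqRHS]card_ord -(@card_in_imset _ _ (f ord0)) ?max_card // => x y.
rewrite !inE !negbK => gx gy exy; exact/esym/(@good_leaf_part x y ord0).
Qed.

End Partition.

(** * The rainbow hypergraph on the leaves *)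

Definition split_at k x y := (take k x == take k y) && (digit x k != digit y k).

Definition rainbow x y z :=
  [exists k : 'I_n, [&& split_at k x y, split_at k y z & split_at k x z]].

Lemma split_atC k x y : split_at k x y = split_at k y x.
Proof. by rewrite /split_at eq_sym [digit x k == _]eq_sym. Qed.

Lemma split_at_lt k x y : split_at k x y -> k < n.
Proof.
case/andP=> _; rewrite ltnNge; apply: contra => nk.
(* From level [n] on, both digits are the default [ord0]. *)
by rewrite /digit !nth_default ?size_tuple.
Qed.

Lemma split_at_inj k l x y : split_at k x y -> split_at l x y -> k = l.
Proof.
have aux k' l' : split_at k' x y -> split_at l' x y -> l' <= k'.
  move=> /andP[_ /negP nd] /andP[/eqP e _]; rewrite leqNgt; apply/negP => kl.
  by apply: nd; rewrite /digit -(nth_take _ kl) e nth_take.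
by move=> h1 h2; apply/eqP; rewrite eqn_leq !aux.
Qed.

Lemma rainbowP x y z : reflect
  (exists k, [/\ split_at k x y, split_at k y z & split_at k x z])
  (rainbow x y z).
Proof.
apply: (iffP existsP) => [[k /and3P[]]|[k [h1 h2 h3]]]; first by exists k.
by exists (Ordinal (split_at_lt h1)); rewrite h1 h2 h3.
Qed.

Lemma rainbowC12 x y z : rainbow x y z = rainbow y x z.
Proof.
apply: eq_existsb => k; rewrite (split_atC k x y).
by do 3 case: (split_at _ _ _).
Qed.

Lemma rainbowC23 x y z : rainbow x y z = rainbow x z y.
Proof.
apply: eq_existsb => k; rewrite (split_atC k y z).
by do 3 case: (split_at _ _ _).
Qed.

Lemma third_digit (a b c c' : 'I_3) :
  a != b -> c != a -> c != b -> c' != a -> c' != b -> c = c'.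
Proof.
move=> ab ca cb c'a c'b; apply: val_inj; move: ab ca cb c'a c'b.
rewrite -!val_eqE /=.
move: (ltn_ord a) (ltn_ord b) (ltn_ord c) (ltn_ord c'); lia.
Qed.

(* Every slice of the graph is thus a disjoint union of complete bipartite
   graphs. *)
Lemma rainbow_rectangle x1 x2 y1 y2 z :
  rainbow x1 y1 z -> rainbow x1 y2 z -> rainbow x2 y2 z -> rainbow x2 y1 z.
Proof.
move=> /rainbowP[k [x1y1 y1z x1z]] /rainbowP[l [x1y2 y2z x1z']].
move=> /rainbowP[m [x2y2 y2z' x2z]]; apply/rainbowP; exists k.
move: x1y2 y2z y2z' x2y2 x2z; rewrite -(split_at_inj x1z x1z') {l x1z'} => x1y2 y2z.
move=> y2z'; rewrite -(split_at_inj y2z y2z') {m y2z'} => x2y2 x2z; split=> //.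
case/andP: x1y1 y1z x1z x1y2 y2z x2y2 x2z => _ d1 /andP[/eqP e1 d2] /andP[_ d3].
move=> /andP[_ d4] /andP[_ d5] /andP[_ d6] /andP[/eqP e2 d7].
rewrite /split_at e1 e2 eqxx /= (_ : digit y1 k = digit y2 k) //.
by apply: (third_digit d3); rewrite // eq_sym.
Qed.

Lemma uniq3 (T : eqType) (a b c : T) :
  uniq [:: a; b; c] -> [/\ a != b, a != c & b != c].
Proof. by rewrite /= !inE negb_or !andbT => /andP[/andP[-> ->] ->]. Qed.

Lemma rainbow_cones s a b c x y z : size s < n -> uniq [:: a; b; c] ->
  x \in cone (rcons s a) -> y \in cone (rcons s b) -> z \in cone (rcons s c) ->
  rainbow x y z.
Proof.
move=> sn /uniq3[ab ac bc].
rewrite !mem_cone_rcons // => /andP[/take_cone ex /eqP dx].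
move=> /andP[/take_cone ey /eqP dy] /andP[/take_cone ez /eqP dz].
apply/rainbowP; exists (size s).
by rewrite /split_at ex ey ez dx dy dz eqxx.
Qed.

(** [y] and [z] part at level [size s], which must be the level of the edge; only one digit is left
    for [x] there. *)
Lemma rainbow_third s a b c x y z : size s < n -> uniq [:: a; b; c] ->
  y \in cone (rcons s b) -> z \in cone (rcons s c) -> rainbow x y z ->
  x \in cone (rcons s a).
Proof.
move=> sn /uniq3[ab ac bc].
rewrite !mem_cone_rcons // => /andP[/take_cone ey /eqP dy].
move=> /andP[/take_cone ez /eqP dz] /rainbowP[k [xy yz xz]].
have ks : k = size s.
  by apply: (split_at_inj yz); rewrite /split_at ey ez dy dz eqxx.
move: xy xz; rewrite ks /split_at ey ez dy dz => /andP[/eqP ex dxb] /andP[_ dxc].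
by rewrite inE prefixE ex eqxx; apply/eqP/(third_digit bc).
Qed.

(** * Homogeneous boxes *)

Definition rainbow_edges : {set n.-tuple 'I_3 * n.-tuple 'I_3 * n.-tuple 'I_3} :=
  [set p | rainbow p.1.1 p.1.2 p.2].

Definition homogeneous A B C :=
  72 ^ 3 * #|rainbow_edges :&: box A B C| < #|box A B C| \/
  72 ^ 3 * #|box A B C :\: rainbow_edges| < #|box A B C|.

Lemma card_box A B C : #|box A B C| = #|A| * #|B| * #|C|.
Proof. by rewrite !cardsX. Qed.

Lemma leq_card_box A B C A' B' C' (F : {set _}) :
  #|A| <= 72 * #|A'| -> #|B| <= 72 * #|B'| -> #|C| <= 72 * #|C'| ->
  box A' B' C' \subset F -> #|box A B C| <= 72 ^ 3 * #|F|.
Proof.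
move=> hA hB hC /subset_leq_card; rewrite !card_box => hF.
apply: leq_trans (leq_mul (leq_mul hA hB) hC) _.
have -> a b c : 72 * a * (72 * b) * (72 * c) = 72 ^ 3 * (a * b * c) by lia.
by rewrite leq_mul2l.
Qed.

Lemma homogeneous_concentrated s a b c A B C :
  size s < n -> uniq [:: a; b; c] -> homogeneous A B C ->
  heavy A (rcons s a) -> heavy B (rcons s b) -> heavy C (rcons s c) ->
  [/\ concentrated A (rcons s a), concentrated B (rcons s b)
    & concentrated C (rcons s c)].
Proof.
move=> sn abc hom hA hB hC; have [ab ac bc] := uniq3 abc.
have bac : uniq [:: b; a; c] by rewrite /= !inE negb_or (eq_sym b a) ab bc ac.
have cab : uniq [:: c; a; b].
  by rewrite /= !inE negb_or (eq_sym c a) (eq_sym c b) ab bc ac.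
case: hom; rewrite ltnNge => /negP hom.
  (* Few edges: impossible, as the three cones span a box full of edges. *)
  case: hom; apply: leq_card_box hA hB hC _.
  apply/subsetP => -[[x y] z]; rewrite !inE /=.
  move=> /andP[/andP[/andP[xA xa] /andP[yB yb]] /andP[zC zc]].
  rewrite xA yB zC !andbT.
  by apply: (rainbow_cones sn abc); rewrite inE.
(* Few non-edges: a part with 1/72 of itself outside its cone would give, with the other two cones,
   a large box without edges. *)
split; rewrite /concentrated ltnNge; apply/negP => h; apply: hom.
- apply: leq_card_box h hB hC _; apply/subsetP => -[[x y] z]; rewrite !inE /=.
  move=> /andP[/andP[/andP[xa xA] /andP[yB yb]] /andP[zC zc]].
  rewrite xA yB zC !andbT; apply: contra xa => r.
  by have := rainbow_third sn abc _ _ r; rewrite !inE; apply.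
- apply: leq_card_box hA h hC _; apply/subsetP => -[[x y] z]; rewrite !inE /=.
  move=> /andP[/andP[/andP[xA xa] /andP[yb yB]] /andP[zC zc]].
  rewrite xA yB zC !andbT rainbowC12; apply: contra yb => r.
  by have := rainbow_third sn bac _ _ r; rewrite !inE; apply.
- apply: leq_card_box hA hB h _; apply/subsetP => -[[x y] z]; rewrite !inE /=.
  move=> /andP[/andP[/andP[xA xa] /andP[yB yb]] /andP[zc zC]].
  rewrite xA yB zC !andbT rainbowC23 rainbowC12; apply: contra zc => r.
  by have := rainbow_third sn cab _ _ r; rewrite !inE; apply.
Qed.

Lemma homogeneous_parts_leq N (f : 'I_3 -> n.-tuple 'I_3 -> 'I_N) : 0 < n ->
  (forall x y z, homogeneous (part f (inord 0) x) (part f (inord 1) y)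
                             (part f (inord 2) z)) ->
  3 ^ n <= 2 * N.
Proof.
move=> n0 hom; apply: (leaves_leq_parts (f := f)) => // s sn als i x j hj.
(* This cyclic shift sends [i] to [j] and assigns distinct children to the three partitions. *)
pose d i' : 'I_3 := (i' + (j - i))%R.
have di : d i = j by rewrite /d GRing.addrC GRing.subrK.
have /= ex i' : exists x', heavy (part f i' x') (rcons s (d i')) /\ (i' = i -> x' = x).
  have [->|ne] := eqVneq i' i; first by exists x; rewrite di.
  have /existsP[x' hx'] := alive_supported i' (d i') als.
  by exists x'; split=> // e; rewrite e eqxx in ne.
have [[x0 [h0 e0]] [x1 [h1 e1]] [x2 [h2 e2]]] :=
  And3 (ex (inord 0)) (ex (inord 1)) (ex (inord 2)).
have ud : uniq [:: d (inord 0); d (inord 1); d (inord 2)].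
  by rewrite (map_inj_uniq (@GRing.addIr _ _) [:: inord 0; inord 1; inord 2]) /=
    !inE -!val_eqE /= !inordK.
have [c0 c1 c2] := homogeneous_concentrated sn ud (hom x0 x1 x2) h0 h1 h2.
have : [\/ i = inord 0, i = inord 1 | i = inord 2].
  have : [|| i == 0 :> nat, i == 1 :> nat | i == 2 :> nat] by move: (ltn_ord i); lia.
  by case/or3P => /eqP e; [apply: Or31|apply: Or32|apply: Or33];
    apply: val_inj; rewrite /= inordK // e.
by rewrite -di; case=> e; rewrite {1 2}e; [rewrite -e0|rewrite -e1|rewrite -e2].
Qed.

End TernaryTree.

(** * Stability of the slices and heredity *)

Lemma rectangle_stable d (A B : finType) (S : {set A * B}) : 1 < d ->
  (forall a a' b b',
     (a, b) \in S -> (a, b') \in S -> (a', b') \in S -> (a', b) \in S) ->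
  stable d S.
Proof.
move=> d1 rect [a [b ab]]; have d0 := ltnW d1.
pose o0 := Ordinal d0; pose o1 := Ordinal d1.
(* The order pattern contains (0,0), (0,1) and (1,1) but not (1,0). *)
have : (a o1, b o0) \in S by apply: (rect (a o0) _ _ (b o1)); apply/ab.
by move/ab.
Qed.

Lemma stable_preim d (A B A' B' : finType) (g : A' -> A) (h : B' -> B)
    (S : {set A * B}) :
  stable d S -> stable d [set p | (g p.1, h p.2) \in S].
Proof.
move=> st [a [b ab]]; apply: st; exists (g \o a), (h \o b) => i j.
by rewrite -ab inE.
Qed.

Lemma slicewise_stable_hereditary d : hereditarily_closed (slicewise_stable d).
Proof.
move=> H [st1 st2 st3] X1 X2 X3 X1n0 X2n0 X3n0; split=> [x|y|z].
- rewrite (_ : slice1 x = [set p | (val p.1, val p.2) \in slice1 (val x)]).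
    exact: stable_preim.
  by apply/setP => p; rewrite !inE.
- rewrite (_ : slice2 y = [set p | (val p.1, val p.2) \in slice2 (val y)]).
    exact: stable_preim.
  by apply/setP => p; rewrite !inE.
- rewrite (_ : slice3 z = [set p | (val p.1, val p.2) \in slice3 (val z)]).
    exact: stable_preim.
  by apply/setP => p; rewrite !inE.
Qed.

Lemma leaves_gt0 n : 0 < #|{: n.-tuple 'I_3}|.
Proof. by rewrite card_tuple card_ord expn_gt0. Qed.

Definition rainbow_graph n : hypergraph :=
  Hypergraph (leaves_gt0 n) (leaves_gt0 n) (leaves_gt0 n) (rainbow_edges n).

Lemma rainbow_graph_stable n d : 1 < d -> slicewise_stable d (rainbow_graph n).
Proof.
move=> d1; split=> v; apply: rectangle_stable => // a a' b b'; rewrite !inE /=.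
- rewrite ![rainbow v _ _]rainbowC12 ![rainbow _ v _]rainbowC23.
  exact: rainbow_rectangle.
- rewrite ![rainbow _ v _]rainbowC23; exact: rainbow_rectangle.
- exact: rainbow_rectangle.
Qed.

(** * From partitions and densities to labels and cardinalities *)

Lemma splits_labelling (T : finType) N (A : nat -> {set T}) : splits N A ->
  exists f : T -> 'I_N, forall x,
    0 < f x /\ [set y | f y == f x] = A (f x).
Proof.
move=> [disj cov].
have ex x : exists t : 'I_N, (0 < t) && (x \in A t).
  have : x \in \bigcup_(1 <= t < N) A t by rewrite cov inE.
  rewrite big_seq_cond.
  apply: (big_ind (fun B : {set T} =>
    x \in B -> exists t : 'I_N, (0 < t) && (x \in A t))) => [|B C hB hC|t].
  - by rewrite inE.
  - by case/setUP.
  - rewrite mem_index_iota andbT => /andP[t0 tN] xt.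
    by exists (Ordinal tN); rewrite t0.
exists (fun x => xchoose (ex x)) => x.
have hf y := xchooseP (ex y).
split; first by case/andP: (hf x).
apply/setP => y; rewrite inE; apply/eqP/idP => [<-|yx].
  by case/andP: (hf y).
have [/andP[x0 _] /andP[y0 yy]] := (hf x, hf y).
apply/eqP/negPn/negP => ne.
have := disj (xchoose (ex y)) (xchoose (ex x)).
rewrite x0 y0 !ltn_ord => /(_ isT isT ne) /disjoint_setI0/setP/(_ y).
by rewrite !inE yx yy.
Qed.

Section Density.
Local Open Scope ring_scope.
Import Order.TTheory GRing.Theory Num.Theory.

Lemma density_homogeneous (R : realType) n (A B C : {set n.-tuple 'I_3}) :
  let D := density R (rainbow_edges n) (box A B C) in
  box A B C != set0 ->
  (D \in `[0, (72 ^ 3)%N%:R^-1[) \/ (D \in `]1 - (72 ^ 3)%N%:R^-1, 1]) ->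
  homogeneous A B C.
Proof.
set E := rainbow_edges n; set X := box A B C; rewrite /density /= => X0.
have X_gt0 : 0 < #|X|%:R :> R by rewrite ltr0n card_gt0.
have k_gt0 : 0 < (72 ^ 3)%N%:R :> R by rewrite ltr0n.
have dE : #|X|%:R = #|E :&: X|%:R + #|X :\: E|%:R :> R.
  by rewrite -natrD -(cardsID E X) setIC.
case; rewrite in_itv /= => /andP[h1 h2]; [left|right]; rewrite -(ltr_nat R) natrM.
  by move: h2; rewrite ltr_pdivrMr // ltr_pdivlMl.
move: h1; rewrite ltr_pdivlMr // mulrBl mul1r ltrBlDl {1}dE addrC ltrD2r.
by rewrite ltr_pdivlMl.
Qed.

End Density.

Theorem theorem7 (R : realType) :
  exists F : hypergraph -> Prop,
    [/\ hereditarily_closed F,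
        forall H : hypergraph, F H -> slicewise_stable 7 H
      & ~ stable_regularity R F].
Proof.
exists (slicewise_stable 7); split=> //; first exact: slicewise_stable_hereditary.
move=> /(_ (72 ^ 3)%N%:R^-1%R).
rewrite Num.Theory.invr_gt0 Num.Theory.ltr0n => /(_ isT)[N reg].
(* This gives [3 ^ n > n > 2 * N >= 2 * N']. *)
pose n := (2 * N).+1.
have [N' [le_N [A1 [A2 [A3 [sp1 sp2 sp3 hom]]]]]] :=
  reg _ (@rainbow_graph_stable n 7 isT).
have [f1 hf1] := splits_labelling sp1.
have [f2 hf2] := splits_labelling sp2.
have [f3 hf3] := splits_labelling sp3.
pose f (i : 'I_3) : n.-tuple 'I_3 -> 'I_N' :=
  match val i with 0 => f1 | 1 => f2 | _ => f3 end.
have : 3 ^ n <= 2 * N'.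
  apply: (homogeneous_parts_leq (f := f)) => // x y z.
  have [[x0 ex] [y0 ey] [z0 ez]] := And3 (hf1 x) (hf2 y) (hf3 z).
  have pE : box (part f (inord 0) x) (part f (inord 1) y) (part f (inord 2) z)
      = box (A1 (f1 x)) (A2 (f2 y)) (A3 (f3 z)).
    by rewrite -ex -ey -ez /part /f /= !inordK.
  rewrite /homogeneous pE; apply: (@density_homogeneous R).
    apply/set0Pn; exists (x, y, z).
    by rewrite /box !in_setX -ex -ey -ez !inE !eqxx.
  apply: hom; rewrite ?x0 ?y0 ?z0 ?ltn_ord //.
  apply/set0Pn; exists (x, y, z).
  by rewrite /box !in_setX -ex -ey -ez !inE !eqxx.
have := @ltn_expl 3 n isT; rewrite /n; lia.
Qed.
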